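(* Let $E$ be a graph and $R$ a unital commutative ring. If $A$ is a $\mathbb{Z}$-graded ring and $\pi: L_R(E) \to A$ is a graded homomorphism with the property that $\pi(rv) \neq 0$ for every $v \in E^0$ and every $r \in R\setminus\{0\}$, then $\pi$ is injective.
   Context: Graphs. A graph $E=(E^0,E^1,r,s)$ consists of sets $E^0$ (vertices) and $E^1$ (edges), of arbitrary cardinality, and maps $r,s:E^1\to E^0$ (range and source). For $v\in E^0$ put $vE^1=s^{-1}(v)$. A vertex $v$ is regular if $vE^1$ is finite and nonempty; $E^0_{\rm reg}$ is the set of regular vertices. A finite path is a sequence $\alpha=\alpha_1\cdots\alpha_n$ of edges with $r(\alpha_i)=s(\alpha_{i+1})$; $|\alpha|=n$, $s(\alpha)=s(\alpha_1)$, $r(\alpha)=r(\alpha_n)$. Vertices are regarded as paths of length $0$ with $r(v)=s(v)=v$. $E^\star$ is the set of finite paths (including vertices). Leavitt path algebras. Rings and algebras are associative but need not be unital. Introduce formal symbols $e^*$ for $e\in E^1$. A Leavitt $E$-family in a ring is a collection of elements $\{v,e,e^*\mid v\in E^0,e\in E^1\}$ satisfying: (V) $v^2=v$, and $vw=0$ for distinct $v,w\in E^0$; (E1) $s(e)e=er(e)=e$ for all $e\in E^1$; (E2) $e^*s(e)=r(e)e^*=e^*$ for all $e\in E^1$; (CK1) $e^*e=r(e)$, and $e^*f=0$ for distinct $e,f\in E^1$; (CK2) $v=\sum_{e\in vE^1}ee^*$ for all $v\in E^0_{\rm reg}$. The Leavitt path algebra $L_R(E)$ is the universal $R$-algebra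 generated by a Leavitt $E$-family $\{v,e,e^*\}$: every $R$-algebra containing a Leavitt $E$-family receives a unique $R$-algebra homomorphism from $L_R(E)$ carrying the generators to the corresponding elements. For $\mu=\mu_1\cdots\mu_n\in E^\star$ of positive length, $\mu^*=\mu_n^*\cdots\mu_1^*$, and $v^*=v$ for $v\in E^0$. $L_R(E)$ is $\mathbb{Z}$-graded with components $L_R(E)_n=\operatorname{span}_R\{\mu\nu^*\mid \mu,\nu\in E^\star,\ r(\mu)=r(\nu),\ |\mu|-|\nu|=n\}$. A $\mathbb{Z}$-graded ring is a ring $A=\bigoplus_{n\in\mathbb{Z}}A_n$ (additive subgroups) with $A_nA_m\subseteq A_{n+m}$. A graded homomorphism of graded rings is a ring homomorphism $f:A\to B$ with $f(A_n)\subseteq B_n$ for all $n$. *)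

(* Defs.v *)
From HB Require Import structures.
From mathcomp Require Import all_boot all_order all_algebra.
From mathcomp Require Import generic_quotient boolp classical_sets cardinality fsbigop.

Set Implicit Arguments.
Unset Strict Implicit.
Unset Printing Implicit Defensive.

Import GRing.Theory.
Local Open Scope classical_set_scope.
Local Open Scope ring_scope.

(* MathComp rings are unital. Rings and algebras that need not have a unit    *)
(* are joins of the additive and multiplicative hierarchies: the product of   *)
(* such a ring is the semigroup product, written x ** y in ring_scope.        *)
Notation "x ** y" := (x * y)%g
  (at level 40, left associativity) : ring_scope.

HB.mixin Record Zmodule_Semigroup_isNuRing A
    of GRing.Zmodule A & Semigroup A := {
  numulDl : forall x y z : A, (x + y) ** z = x ** z + y ** z;
  numulDr : forall x y z : A, x ** (y + z) = x ** y + x ** z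
}.

#[short(type="nuRingType")]
HB.structure Definition NuRing :=
  {A of GRing.Zmodule A & Semigroup A & Zmodule_Semigroup_isNuRing A}.

HB.mixin Record Lmodule_NuRing_isNuAlgebra (R : comPzRingType) A
    of GRing.Lmodule R A & NuRing A := {
  nuscalerAl : forall (a : R) (x y : A), a *: (x ** y) = (a *: x) ** y;
  nuscalerAr : forall (a : R) (x y : A), a *: (x ** y) = x ** (a *: y)
}.

#[short(type="nuAlgType")]
HB.structure Definition NuAlgebra (R : comPzRingType) :=
  {A of GRing.Lmodule R A & NuRing A & Lmodule_NuRing_isNuAlgebra R A}.

Definition nu_ring_hom (A B : nuRingType) (f : A -> B) : Prop :=
  {morph f : x y / x + y} /\ {morph f : x y / x ** y}.

Definition nu_alg_hom (R : comPzRingType) (A B : nuAlgType R) (f : A -> B) :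
  Prop := nu_ring_hom f /\ scalable f.

Definition graded_ring (A : nuRingType) (A_ : int -> set A) : Prop :=
  [/\ forall n, A_ n 0 /\ (forall x y, A_ n x -> A_ n y -> A_ n (x - y)),
      forall m n x y, A_ m x -> A_ n y -> A_ (m + n) (x ** y),
      forall x, exists (s : seq int) (f : int -> A),
        [/\ uniq s, forall n, A_ n (f n) & x = \sum_(n <- s) f n]
    & forall (s : seq int) (f : int -> A), uniq s ->
        (forall n, A_ n (f n)) -> \sum_(n <- s) f n = 0 ->
        forall n, n \in s -> f n = 0].

Definition graded_hom (A B : nuRingType) (A_ : int -> set A) (B_ : int -> set B)
    (f : A -> B) : Prop :=
  nu_ring_hom f /\ forall n x, A_ n x -> B_ n (f x).

(* By classical choice every type carries a choiceType structure              *)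
(* (boolp.gen_choiceMixin), so arbitrary vertex and edge sets are covered.    *)
Record graph := Graph {
  vertex : choiceType;
  edge : choiceType;
  rng : edge -> vertex;
  src : edge -> vertex
}.

Section Paths.
Variable E : graph.

Definition out_edges (v : vertex E) : set (edge E) := [set e | src e = v].

Definition regular (v : vertex E) : Prop :=
  finite_set (out_edges v) /\ out_edges v !=set0.

Definition walk_from (v : vertex E) (p : seq (edge E)) : bool :=
  if p is e :: p' then
    (src e == v) && path [rel f g : edge E | rng f == src g] e p'
  else true.

(* A path of length 0 is its source vertex.                                   *)
Record fpath := FPath {
  fp_src : vertex E;
  fp_edges : seq (edge E);
  fp_walk : walk_from fp_src fp_edges
}.

Definition fp_rng (p : fpath) : vertex E :=
  last (fp_src p) (map (@rng E) (fp_edges p)).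

Definition fp_len (p : fpath) : nat := size (fp_edges p).

End Paths.

Record Efamily (E : graph) (B : Type) := MkEfamily {
  fv : vertex E -> B;
  fe : edge E -> B;
  fs : edge E -> B (* the ghost edges e^* *)
}.

Definition leavitt_family (E : graph) (B : nuRingType) (g : Efamily E B) : Prop :=
  [/\ (forall v, fv g v ** fv g v = fv g v) /\
      (forall v w, v <> w -> fv g v ** fv g w = 0),
      forall e, fv g (src e) ** fe g e = fe g e /\
                fe g e ** fv g (rng e) = fe g e,
      forall e, fs g e ** fv g (src e) = fs g e /\
                fv g (rng e) ** fs g e = fs g e,
      (forall e, fs g e ** fe g e = fv g (rng e)) /\
      (forall e f, e <> f -> fs g e ** fe g f = 0)
    & forall v, regular v ->
        fv g v = \sum_(e \in out_edges v) fe g e ** fs g e].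

Definition carries (E : graph) (A B : Type) (f : A -> B)
    (g : Efamily E A) (h : Efamily E B) : Prop :=
  [/\ forall v, f (fv g v) = fv h v,
      forall e, f (fe g e) = fe h e
    & forall e, f (fs g e) = fs h e].

(* L, with the family g, is a model of the Leavitt path algebra L_R(E).       *)
(* Existence of a model: leavitt_path_algebra_exists below.                   *)
Definition is_leavitt_path_algebra (R : comPzRingType) (E : graph)
    (L : nuAlgType R) (g : Efamily E L) : Prop :=
  leavitt_family g /\
  forall (B : nuAlgType R) (h : Efamily E B), leavitt_family h ->
    exists phi : L -> B,
      [/\ nu_alg_hom phi, carries phi g h
        & forall psi : L -> B, nu_alg_hom psi -> carries psi g h -> psi =1 phi].

Section Monomials.
Variables (E : graph) (B : nuRingType) (g : Efamily E B).

Definition path_elt (p : fpath E) : B :=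
  if fp_edges p is e :: s then foldl (fun x f => x ** fe g f) (fe g e) s
  else fv g (fp_src p).

Definition ghost_elt (p : fpath E) : B :=
  if fp_edges p is e :: s then foldl (fun x f => fs g f ** x) (fs g e) s
  else fv g (fp_src p).

End Monomials.

(* The component L_R(E)_n, as the set of finite R-linear combinations of the  *)
(* monomials mu nu^* of degree n.                                             *)
Definition leavitt_component (R : comPzRingType) (E : graph) (L : nuAlgType R)
    (g : Efamily E L) (n : int) : set L :=
  [set x | exists (k : nat) (c : 'I_k -> R) (mu nu : 'I_k -> fpath E),
     (forall i, fp_rng (mu i) = fp_rng (nu i) /\
                (fp_len (mu i))%:Z - (fp_len (nu i))%:Z = n) /\
     x = \sum_(i < k) c i *: (path_elt g (mu i) ** ghost_elt g (nu i))].

Section Existence.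
Local Open Scope quotient_scope.
Variables (R : comPzRingType) (E : graph).

Inductive term : Type :=
| TV of vertex E | TE of edge E | TS of edge E
| TZero | TOpp of term | TAdd of term & term
| TMul of term & term | TScale of R & term.

Fixpoint teval (B : nuAlgType R) (h : Efamily E B) (t : term) : B :=
  match t with
  | TV v => fv h v | TE e => fe h e | TS e => fs h e
  | TZero => 0 | TOpp t => - teval h t
  | TAdd t u => teval h t + teval h u
  | TMul t u => teval h t ** teval h u
  | TScale a t => a *: teval h t
  end.

HB.instance Definition _ := gen_eqMixin term.
HB.instance Definition _ := gen_choiceMixin term.

(* Two terms are identified when every Leavitt family gives them the same     *)
(* value, i.e. when they agree modulo the Leavitt relations.                  *)
Definition teq : rel term := fun t u =>
  `[< forall (B : nuAlgType R) (h : Efamily E B), leavitt_family h ->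
      teval h t = teval h u >].

Fact teq_refl : reflexive teq. Proof. by move=> t; apply/asboolP. Qed.
Fact teq_sym : symmetric teq.
Proof.
by move=> t u; apply/asboolP/asboolP => H B h hh; rewrite (H B h hh).
Qed.
Fact teq_trans : transitive teq.
Proof.
move=> u t w /asboolP H1 /asboolP H2; apply/asboolP => B h hh.
by rewrite (H1 B h hh) (H2 B h hh).
Qed.
Canonical teq_equiv := EquivRel teq teq_refl teq_sym teq_trans.

Definition lpa : Type := {eq_quot teq}.
HB.instance Definition _ := Choice.on lpa.

Local Notation cls t := (\pi_({eq_quot teq}) t : lpa).

Definition leval (B : nuAlgType R) (h : Efamily E B) (x : lpa) : B :=
  teval h (repr (x : {eq_quot teq})).

Lemma leval_cls (B : nuAlgType R) (h : Efamily E B) : leavitt_family h ->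
  forall t, leval h (cls t) = teval h t.
Proof.
move=> hh t; rewrite /leval; case: piP => u /eqmodP /asboolP H.
by rewrite (H B h hh).
Qed.

Lemma lpaP (x y : lpa) :
  (forall (B : nuAlgType R) (h : Efamily E B), leavitt_family h ->
     leval h x = leval h y) -> x = y.
Proof.
by move=> H; rewrite -[x]reprK -[y]reprK; apply/eqmodP/asboolP.
Qed.

Definition lzero : lpa := cls TZero.
Definition lopp (x : lpa) : lpa := cls (TOpp (repr x)).
Definition ladd (x y : lpa) : lpa := cls (TAdd (repr x) (repr y)).
Definition lmul (x y : lpa) : lpa := cls (TMul (repr x) (repr y)).
Definition lscale (a : R) (x : lpa) : lpa := cls (TScale a (repr x)).

Lemma levalE (B : nuAlgType R) (h : Efamily E B) : leavitt_family h ->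
  (leval h lzero = 0) *
  (forall x, leval h (lopp x) = - leval h x) *
  (forall x y, leval h (ladd x y) = leval h x + leval h y) *
  (forall x y, leval h (lmul x y) = leval h x ** leval h y) *
  (forall a x, leval h (lscale a x) = a *: leval h x).
Proof. by move=> hh; do !split=> *; rewrite (leval_cls hh). Qed.

Fact laddA : associative ladd.
Proof. by move=> x y z; apply: lpaP => B h hh; rewrite !(levalE hh) addrA. Qed.
Fact laddC : commutative ladd.
Proof. by move=> x y; apply: lpaP => B h hh; rewrite !(levalE hh) addrC. Qed.
Fact ladd0 : left_id lzero ladd.
Proof. by move=> x; apply: lpaP => B h hh; rewrite !(levalE hh) add0r. Qed.
Fact laddN : left_inverse lzero lopp ladd.
Proof. by move=> x; apply: lpaP => B h hh; rewrite !(levalE hh) addNr. Qed.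
HB.instance Definition _ := GRing.isZmodule.Build lpa laddA laddC ladd0 laddN.

Fact lmulA : associative lmul.
Proof. by move=> x y z; apply: lpaP => B h hh; rewrite !(levalE hh) mulgA. Qed.
HB.instance Definition _ := isSemigroup.Build lpa lmulA.

Fact lmulDl : left_distributive lmul ladd.
Proof.
by move=> x y z; apply: lpaP => B h hh; rewrite !(levalE hh) numulDl.
Qed.
Fact lmulDr : right_distributive lmul ladd.
Proof.
by move=> x y z; apply: lpaP => B h hh; rewrite !(levalE hh) numulDr.
Qed.
HB.instance Definition _ := Zmodule_Semigroup_isNuRing.Build lpa lmulDl lmulDr.

Fact lscaleA a b x : lscale a (lscale b x) = lscale (a * b) x.
Proof. by apply: lpaP => B h hh; rewrite !(levalE hh) scalerA. Qed.
Fact lscale1 : left_id 1 lscale.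
Proof. by move=> x; apply: lpaP => B h hh; rewrite !(levalE hh) scale1r. Qed.
Fact lscaleDr : right_distributive lscale ladd.
Proof.
by move=> a x y; apply: lpaP => B h hh; rewrite !(levalE hh) scalerDr.
Qed.
Fact lscaleDl x a b : lscale (a + b) x = ladd (lscale a x) (lscale b x).
Proof. by apply: lpaP => B h hh; rewrite !(levalE hh) scalerDl. Qed.
HB.instance Definition _ :=
  GRing.Zmodule_isLmodule.Build R lpa lscaleA lscale1 lscaleDr lscaleDl.

Fact lscaleAl a x y : lscale a (lmul x y) = lmul (lscale a x) y.
Proof. by apply: lpaP => B h hh; rewrite !(levalE hh) nuscalerAl. Qed.
Fact lscaleAr a x y : lscale a (lmul x y) = lmul x (lscale a y).
Proof. by apply: lpaP => B h hh; rewrite !(levalE hh) nuscalerAr. Qed.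
HB.instance Definition _ :=
  Lmodule_NuRing_isNuAlgebra.Build R lpa lscaleAl lscaleAr.

Definition lpa_family : Efamily E lpa :=
  MkEfamily (fun v => cls (TV v)) (fun e => cls (TE e)) (fun e => cls (TS e)).

Lemma leval_hom (B : nuAlgType R) (h : Efamily E B) : leavitt_family h ->
  nu_alg_hom (leval h).
Proof.
by move=> hh; split; [split=> x y|move=> a x]; rewrite (leval_cls hh).
Qed.

Lemma lpa_leavitt : leavitt_family lpa_family.
Proof.
have M (B : nuAlgType R) (h : Efamily E B) (hh : leavitt_family h) x y :
  leval h (x ** y) = leval h x ** leval h y by case: (leval_hom hh) => -[].
have Z (B : nuAlgType R) (h : Efamily E B) (hh : leavitt_family h) :
  leval h 0 = 0 by rewrite (leval_cls hh).
split.
- split=> [v|v w nvw]; apply/lpaP => B h hh;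
    rewrite M // ?Z // !(leval_cls hh) /=; case: hh => -[hv hw] _ _ _ _;
    [exact: hv|exact: hw].
- move=> e; split; apply/lpaP => B h hh;
    rewrite M // !(leval_cls hh) /=; case: hh => _ H _ _ _;
    by case: (H e).
- move=> e; split; apply/lpaP => B h hh;
    rewrite M // !(leval_cls hh) /=; case: hh => _ _ H _ _;
    by case: (H e).
- split=> [e|e f nef]; apply/lpaP => B h hh;
    rewrite M // ?Z // !(leval_cls hh) /=; case: hh => _ _ _ [hv hw] _;
    [exact: hv|exact: hw].
- move=> v rv; apply/lpaP => B h hh.
  case: (rv) => finv _; rewrite fsbig_finite //=.
  have D x y : leval h (x + y) = leval h x + leval h y.
    by case: (leval_hom hh) => -[].
  rewrite (big_morph (leval h) D (Z _ _ hh)) (leval_cls hh) /=.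
  under eq_bigr => e _ do rewrite M // !(leval_cls hh) /=.
  by rewrite -fsbig_finite //; case: hh => _ _ _ _ /(_ _ rv).
Qed.

Lemma lpa_universal : is_leavitt_path_algebra lpa_family.
Proof.
split=> [|B h hh]; first exact: lpa_leavitt.
exists (leval h); split; first exact: leval_hom.
  by split=> ?; rewrite (leval_cls hh).
move=> psi [[psiD psiM] psiZ] [cv ce cs] x.
have psi0 : psi 0 = 0 by apply: (addrI (psi 0)); rewrite -psiD !addr0.
have psiN y : psi (- y) = - psi y.
  by apply: (addrI (psi y)); rewrite -psiD !subrr.
have step (t : term) : psi (cls t) = teval h t.
  elim: t => [v|e|e||t IH|t IHt u IHu|t IHt u IHu|a t IH] /=.
  - exact: cv.
  - exact: ce.
  - exact: cs.
  - exact: psi0.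
  - rewrite -IH -psiN; congr psi; apply/lpaP => C k kk.
    by rewrite !(leval_cls kk) /= -/(leval _ _) (leval_cls kk).
  - rewrite -IHt -IHu -psiD; congr psi; apply/lpaP => C k kk.
    by rewrite !(leval_cls kk) /= -!/(leval _ _) !(leval_cls kk).
  - rewrite -IHt -IHu -psiM; congr psi; apply/lpaP => C k kk.
    by rewrite !(leval_cls kk) /= -!/(leval _ _) !(leval_cls kk).
  - rewrite -IH -psiZ; congr psi; apply/lpaP => C k kk.
    by rewrite !(leval_cls kk) /= -/(leval _ _) (leval_cls kk).
by rewrite /leval -step reprK.
Qed.

End Existence.

Lemma leavitt_path_algebra_exists (R : comPzRingType) (E : graph) :
  exists (L : nuAlgType R) (g : Efamily E L), is_leavitt_path_algebra g.
Proof. by exists (lpa R E), (lpa_family R E); exact: lpa_universal. Qed.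

(* Main.v *)
Require Import Defs.
From mathcomp Require Import all_boot all_order all_algebra.
From mathcomp Require Import boolp classical_sets.
From mathcomp Require Import generic_quotient cardinality fsbigop.
Import GRing.Theory.
Local Open Scope ring_scope.


(** Write m = mu nu^* for the monomials of L_R(E). They span L_R(E)
    (leavitt_generated, span_teval), so an element x of the kernel of pi is a
    finite sum of homogeneous elements x_n. The values pi x_n lie in different
    components of A and have sum 0, so each of them is 0. It remains to see
    that a homogeneous element x of the kernel is 0. Only three properties of
    the kernel J matter for this: it absorbs multiplication on the left and on
    the right, and it contains no r v with r <> 0.

    A homogeneous x is a combination of monomials mu nu^* with
    |mu| = a + k, |nu| = b + k and k <= d, for some a, b, d (diag_span). The
    proof is an induction on d.

    If a > 0, every monomial begins with an edge, hence x is the sum of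
    e (e^* x) over finitely many edges e, and e^* x lies in J and has a
    smaller a. Symmetrically for b on the right, so one may assume a = b = 0
    (ideal_diag_span0). Then x = z + y, where z is a combination of vertices
    c_v v and y involves only monomials with k > 0. If d = 0 then y = 0, and
    c_v v = v x is in J, so c_v = 0.

    If d > 0, the coefficient of a singular vertex v vanishes
    (singular_coefficient0). Indeed, an infinite emitter v has an edge e which
    begins no monomial of y, so that e^* x e = c_v r(e) lies in J; and if v is
    a sink then v y = 0 and v x = c_v v lies in J. The coefficients left over
    sit at regular vertices, where (CK2) turns v into a sum of monomials e e^*.
    So x is a combination of monomials with k > 0, that is, a, b, d may be
    replaced with 1, 1, d - 1, and the induction hypothesis applies. *)

(** * Rings without unit *)

Section NuRing.
Variable A : nuRingType.
Implicit Types x y : A.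

Lemma numul0r x : 0 ** x = 0.
Proof. by apply: (addrI (0 ** x)); rewrite -numulDl !addr0. Qed.

Lemma numulr0 x : x ** 0 = 0.
Proof. by apply: (addrI (x ** 0)); rewrite -numulDr !addr0. Qed.

Lemma numul_sumr x (I : Type) (s : seq I) (F : I -> A) :
  x ** (\sum_(i <- s) F i) = \sum_(i <- s) x ** F i.
Proof. by apply: big_morph; [exact: numulDr|exact: numulr0]. Qed.

End NuRing.

(** * Sums with finite support *)

Section FiniteSums.
Set Implicit Arguments.
Unset Strict Implicit.
Context {V : zmodType} {I : choiceType}.

(** The sum is required over every finite set of indices that contains the
    support, rather than over one such set, so that two sums over different
    supports can be added without reindexing. *)
Definition finsum_to (F : I -> V) (x : V) : Prop :=
  exists s : seq I, forall s', uniq s' -> {subset s <= s'} ->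
    \sum_(i <- s') F i = x.

Lemma finsum_toD (F G : I -> V) x y :
  finsum_to F x -> finsum_to G y -> finsum_to (fun i => F i + G i) (x + y).
Proof.
move=> [s hs] [t ht]; exists (s ++ t) => s' us' sub.
rewrite big_split /= hs // ?ht // => i hi; apply: sub;
  by rewrite mem_cat hi ?orbT.
Qed.

Lemma finsum_to0 : finsum_to (fun=> 0) 0.
Proof. by exists [::] => s' _ _; rewrite big1. Qed.

Lemma finsum_to_single (F : I -> V) i x :
  F i = x -> (forall j, j != i -> F j = 0) -> finsum_to F x.
Proof.
move=> <- F0; exists [:: i] => s' us' sub.
have is' : i \in s' by apply: sub; rewrite mem_head.
by rewrite (bigD1_seq i) //= big1 ?addr0.
Qed.

Lemma finsum_to_seq (F : I -> V) x :
  finsum_to F x -> exists2 s, uniq s & x = \sum_(i <- s) F i.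
Proof.
move=> [s hs]; exists (undup s); first exact: undup_uniq.
by rewrite hs ?undup_uniq // => i; rewrite mem_undup.
Qed.

Lemma finsum_to_eq {F G : I -> V} {x y} :
  F =1 G -> x = y -> finsum_to F x -> finsum_to G y.
Proof. by move=> /funext -> ->. Qed.

End FiniteSums.

(** * Linear spans *)

Section Span.
Set Implicit Arguments.
Unset Strict Implicit.
Context {R : comPzRingType} {V : lmodType R}.
Implicit Types (G : V -> Prop) (x y : V).

Inductive lspan G : V -> Prop :=
| lspan_nil : lspan G 0
| lspanD x y : lspan G x -> lspan G y -> lspan G (x + y)
| lspan_mul c m : G m -> lspan G (c *: m).

Lemma lspanZ G a x : lspan G x -> lspan G (a *: x).
Proof.
elim=> [|y z _ IHy _ IHz|c m Gm].
- by rewrite scaler0; exact: lspan_nil.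
- by rewrite scalerDr; exact: lspanD.
- by rewrite scalerA; exact: lspan_mul.
Qed.

Lemma lspan_gen G m : G m -> lspan G m.
Proof. by move=> Gm; rewrite -[m]scale1r; exact: lspan_mul. Qed.

Lemma lspan_sum G (I : Type) (s : seq I) (P : pred I) (F : I -> V) :
  (forall i, P i -> lspan G (F i)) -> lspan G (\sum_(i <- s | P i) F i).
Proof.
move=> hF; apply: big_ind => //; first exact: lspan_nil.
by move=> *; exact: lspanD.
Qed.

End Span.

(** * Generators and relations of a Leavitt path algebra *)

Section LeavittPathAlgebra.
Set Implicit Arguments.
Unset Strict Implicit.
Context {E : graph} {R : comPzRingType} {L : nuAlgType R} {g : Efamily E L}.

(** The universal property gives maps between L and the concrete model, whose
    elements are classes of terms. By uniqueness their composite on L is the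
    identity, so every x is the value of a term representing its image in the
    model. This reduces statements on L to inductions on terms. *)
Lemma leavitt_generated :
  is_leavitt_path_algebra g -> forall x : L, exists t, x = teval g t.
Proof.
move=> [hg univ] x.
have [phi [[[phiD phiM] phiZ] [cv ce cs] _]] := univ _ _ (lpa_leavitt R E).
have [[evD evM] evZ] := leval_hom hg.
have [theta [_ _ uniq_theta]] := univ _ _ hg.
exists (repr (phi x : {eq_quot @teq R E}%qT)).
rewrite -/(leval g (phi x)).
transitivity (theta x); first by apply: (uniq_theta id).
symmetry; apply: (uniq_theta (fun z => leval g (phi z))).
- split=> [|a z]; last by rewrite phiZ evZ.
  by split=> y z; rewrite ?phiD ?phiM.
- by split=> ?; rewrite ?cv ?ce ?cs (leval_cls hg).
Qed.

Hypothesis hg : leavitt_family g.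

Lemma fvv v : fv g v ** fv g v = fv g v.
Proof. by case: hg => -[]. Qed.

Lemma fvw v w : v != w -> fv g v ** fv g w = 0.
Proof. by case: hg => -[_ H] _ _ _ _ /eqP; exact: H. Qed.

Lemma src_fe e : fv g (src e) ** fe g e = fe g e.
Proof. by case: hg => _ /(_ e) []. Qed.

Lemma fe_rng e : fe g e ** fv g (rng e) = fe g e.
Proof. by case: hg => _ /(_ e) []. Qed.

Lemma fs_src e : fs g e ** fv g (src e) = fs g e.
Proof. by case: hg => _ _ /(_ e) []. Qed.

Lemma rng_fs e : fv g (rng e) ** fs g e = fs g e.
Proof. by case: hg => _ _ /(_ e) []. Qed.

Lemma fs_fe e : fs g e ** fe g e = fv g (rng e).
Proof. by case: hg => _ _ _ []. Qed.

Lemma fs_fe0 e f : e != f -> fs g e ** fe g f = 0.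
Proof. by case: hg => _ _ _ [_ H] _ /eqP; exact: H. Qed.

(** * Paths and monomials *)

Section Paths.
Implicit Types p q : Defs.fpath E.

Lemma path_elt_nil p :
  fp_len p = 0%N -> [/\ fp_rng p = fp_src p, path_elt g p = fv g (fp_src p)
                     & ghost_elt g p = fv g (fp_src p)].
Proof. by case: p => v [|e s]. Qed.

(** Both elements are left folds starting at the first edge; associativity and
    the relations at the range of e move that edge outside the fold. *)
Lemma path_elt_consE v e s (h : walk_from v (e :: s))
    (h' : walk_from (rng e) s) :
  path_elt g (FPath h) = fe g e ** path_elt g (FPath h') /\
  ghost_elt g (FPath h) = ghost_elt g (FPath h') ** fs g e.
Proof.
case: s h h' => [|f s] h h'; rewrite /path_elt /ghost_elt /=.
  by rewrite fe_rng rng_fs.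
split.
  by elim: s (fe g f) {h h'} => [//|f' s IH] z /=; rewrite -IH mulgA.
by elim: s (fs g f) {h h'} => [//|f' s IH] z /=; rewrite -IH mulgA.
Qed.

Lemma path_uncons p n : fp_len p = n.+1 ->
  exists e p', [/\ fp_src p = src e, fp_src p' = rng e, fp_len p' = n,
                   fp_rng p' = fp_rng p
                 & path_elt g p = fe g e ** path_elt g p' /\
                   ghost_elt g p = ghost_elt g p' ** fs g e].
Proof.
case: p => v [//|e s] h [sn].
have h' : walk_from (rng e) s.
  by move: h => /= /andP[_]; case: {sn} s => //= f s; rewrite eq_sym.
exists e, (FPath h'); split=> //; last exact: path_elt_consE.
by case/andP: (h) => /eqP ->.
Qed.

Lemma path_cons e p : fp_src p = rng e ->
  exists p', [/\ fp_src p' = src e, fp_len p' = (fp_len p).+1,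
                   fp_rng p' = fp_rng p
                 & path_elt g p' = fe g e ** path_elt g p /\
                   ghost_elt g p' = ghost_elt g p ** fs g e].
Proof.
case: p => v s /= h vE; move: h; rewrite {}vE => h.
have h' : walk_from (src e) (e :: s).
  by move: h; rewrite /= eqxx /=; case: s => //= f s; rewrite eq_sym.
by exists (FPath h'); split=> //; exact: path_elt_consE.
Qed.

Lemma src_path p : fv g (fp_src p) ** path_elt g p = path_elt g p.
Proof.
case n: (fp_len p) => [|k].
  by have [_ -> _] := path_elt_nil n; rewrite fvv.
by have [e [p' [-> _ _ _ [-> _]]]] := path_uncons n; rewrite mulgA src_fe.
Qed.

Lemma ghost_src p : ghost_elt g p ** fv g (fp_src p) = ghost_elt g p.
Proof.
case n: (fp_len p) => [|k].
  by have [_ _ ->] := path_elt_nil n; rewrite fvv.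
by have [e [p' [-> _ _ _ [_ ->]]]] := path_uncons n; rewrite -mulgA fs_src.
Qed.

Lemma rng_ghost p : fv g (fp_rng p) ** ghost_elt g p = ghost_elt g p.
Proof.
move n: (fp_len p) => k; elim: k p n => [|k IH] p n.
  by have [-> _ ->] := path_elt_nil n; rewrite fvv.
have [e [p' [_ _ n' <- [_ ->]]]] := path_uncons n.
by rewrite mulgA IH.
Qed.

End Paths.

Definition monomial (a b : nat) (m : L) : Prop :=
  exists p q : Defs.fpath E,
    [/\ fp_rng p = fp_rng q, fp_len p = a, fp_len q = b
      & m = path_elt g p ** ghost_elt g q].

Definition vertex_path (v : vertex E) : Defs.fpath E := @FPath E v [::] isT.

Lemma monomial_vertex v : monomial 0 0 (fv g v).
Proof.
by exists (vertex_path v), (vertex_path v); split; rewrite // /path_elt /= fvv.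
Qed.

Lemma monomial00 m : monomial 0 0 m -> exists v, m = fv g v.
Proof.
move=> [p [q [rpq p0 q0 ->]]].
have [rp -> _] := path_elt_nil p0; have [rq _ ->] := path_elt_nil q0.
by exists (fp_src p); rewrite -rp rpq rq fvv.
Qed.

Lemma monomial_unconsl a b m : monomial a.+1 b m ->
  exists e m', [/\ m = fe g e ** m', monomial a b m'
                 & fv g (rng e) ** m' = m'].
Proof.
move=> [p [q [rpq pa qb ->]]].
have [e [p' [_ sp' pa' rp' [-> _]]]] := path_uncons pa.
exists e, (path_elt g p' ** ghost_elt g q); split; first by rewrite mulgA.
  by exists p', q; rewrite rp'.
by rewrite mulgA -sp' src_path.
Qed.

Lemma monomial_unconsr a b m : monomial a b.+1 m ->
  exists e m', [/\ m = m' ** fs g e, monomial a b m'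
                 & m' ** fv g (rng e) = m'].
Proof.
move=> [p [q [rpq pa qb ->]]].
have [e [q' [_ sq' qb' rq' [_ ->]]]] := path_uncons qb.
exists e, (path_elt g p ** ghost_elt g q'); split; first by rewrite mulgA.
  by exists p, q'; rewrite rq'.
by rewrite -mulgA -sq' ghost_src.
Qed.

Lemma vertex_monomial v a b m : monomial a b m ->
  fv g v ** m = m \/ fv g v ** m = 0.
Proof.
move=> [p [q [_ _ _ ->]]]; rewrite -(src_path p) !mulgA.
by have [->|nv] := eqVneq v (fp_src p);
  [left; rewrite fvv|right; rewrite fvw // !numul0r].
Qed.

(** If e does not end where the monomial starts, then inserting the two
    orthogonal vertices between them shows that the product vanishes. *)
Lemma fe_monomial e a b m : monomial a b m ->
  monomial a.+1 b (fe g e ** m) \/ fe g e ** m = 0.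
Proof.
move=> [p [q [rpq pa qb ->]]]; have [sp|np] := eqVneq (fp_src p) (rng e).
  left; have [p' [_ pa' rp' [E1 _]]] := path_cons sp.
  by exists p', q; rewrite rp' pa' pa E1 mulgA.
right; rewrite -(src_path p) -fe_rng !mulgA -(mulgA (fe g e)) fvw 1?eq_sym //.
by rewrite numulr0 !numul0r.
Qed.

Lemma monomial_fs e a b m : monomial a b m ->
  monomial a b.+1 (m ** fs g e) \/ m ** fs g e = 0.
Proof.
move=> [p [q [rpq pa qb ->]]]; have [sq|nq] := eqVneq (fp_src q) (rng e).
  left; have [q' [_ qb' rq' [_ E1]]] := path_cons sq.
  by exists p, q'; rewrite rq' qb' qb E1 mulgA.
right; rewrite -(ghost_src q) -rng_fs -!mulgA (mulgA (fv g (fp_src q))).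
by rewrite fvw // numul0r !numulr0.
Qed.

(** * Monomials span the algebra *)

Definition any_monomial (m : L) : Prop := exists a b, monomial a b m.

Lemma span_monomial_or0 m : any_monomial m \/ m = 0 -> lspan any_monomial m.
Proof. by case=> [/lspan_gen//|->]; exact: lspan_nil. Qed.

Lemma span_mul_fs e x :
  lspan any_monomial x -> lspan any_monomial (x ** fs g e).
Proof.
elim=> [|y z _ IHy _ IHz|c m [a [b hm]]].
- by rewrite numul0r; exact: lspan_nil.
- by rewrite numulDl; exact: lspanD.
- rewrite -nuscalerAl; apply/lspanZ/span_monomial_or0.
  by have [h|->] := monomial_fs e hm; [left; exists a, b.+1|right].
Qed.

Lemma span_fv v : lspan any_monomial (fv g v).
Proof. by apply: lspan_gen; exists 0%N, 0%N; exact: monomial_vertex. Qed.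

Lemma span_fe e : lspan any_monomial (fe g e).
Proof.
rewrite -fe_rng; apply: span_monomial_or0.
have [h|->] := fe_monomial e (monomial_vertex (rng e)); last by right.
by left; exists 1%N, 0%N.
Qed.

Lemma span_fs e : lspan any_monomial (fs g e).
Proof. by rewrite -rng_fs; apply: span_mul_fs; exact: span_fv. Qed.

(** The ghost of a path grows on the left when the path is extended at its end.
    The induction instead removes the first edge of q, whose ghost is the last
    factor, and puts it back by span_mul_fs. *)
Lemma span_fs_ghost e q : lspan any_monomial (fs g e ** ghost_elt g q).
Proof.
move n: (fp_len q) => k; elim: k q n => [|k IH] q n.
  have [_ _ ->] := path_elt_nil n.
  have [<-|ne] := eqVneq (src e) (fp_src q).
    by rewrite fs_src; exact: span_fs.
  by rewrite -fs_src -mulgA fvw // numulr0; exact: lspan_nil.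
have [f [q' [_ _ n' _ [_ ->]]]] := path_uncons n.
by rewrite mulgA; apply: span_mul_fs; exact: IH.
Qed.

Lemma fs_fe_mul e f m : fv g (rng f) ** m = m ->
  fs g e ** (fe g f ** m) = if e == f then m else 0.
Proof.
move=> hm; rewrite mulgA; have [->|nef] := eqVneq; first by rewrite fs_fe.
by rewrite fs_fe0 // numul0r.
Qed.

Lemma mul_fs_fe e f m : m ** fv g (rng f) = m ->
  m ** fs g f ** fe g e = if f == e then m else 0.
Proof.
move=> hm; rewrite -mulgA; have [<-|nef] := eqVneq; first by rewrite fs_fe.
by rewrite fs_fe0 // numulr0.
Qed.

Lemma span_generator_mul (y : L) :
  (forall m, any_monomial m -> lspan any_monomial (y ** m)) ->
  forall x, lspan any_monomial x -> lspan any_monomial (y ** x).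
Proof.
move=> hy x; elim=> [|x1 x2 _ IH1 _ IH2|c m /hy hm].
- by rewrite numulr0; exact: lspan_nil.
- by rewrite numulDr; exact: lspanD.
- by rewrite -nuscalerAr; apply: lspanZ.
Qed.

Lemma span_fv_mul v x :
  lspan any_monomial x -> lspan any_monomial (fv g v ** x).
Proof.
apply: span_generator_mul => m [a [b hm]]; apply: span_monomial_or0.
by have [->|->] := vertex_monomial v hm; [left; exists a, b|right].
Qed.

Lemma span_fe_mul e x :
  lspan any_monomial x -> lspan any_monomial (fe g e ** x).
Proof.
apply: span_generator_mul => m [a [b hm]]; apply: span_monomial_or0.
by have [h|->] := fe_monomial e hm; [left; exists a.+1, b|right].
Qed.

Lemma span_fs_mul e x :
  lspan any_monomial x -> lspan any_monomial (fs g e ** x).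
Proof.
apply: span_generator_mul => m [[|a] [b hm]].
  case: hm => p [q [rpq p0 _ ->]]; have [rp -> _] := path_elt_nil p0.
  by rewrite -rp rpq rng_ghost; exact: span_fs_ghost.
have [f [m' [-> hm' rm']]] := monomial_unconsl hm.
rewrite fs_fe_mul //; apply: span_monomial_or0.
by case: ifP; [left; exists a, b|right].
Qed.

Lemma span_teval t : lspan any_monomial (teval g t).
Proof.
(* The second half is what makes the induction pass through products: it lets
   one multiply a known combination by the generators one at a time. *)
suff [] : lspan any_monomial (teval g t) /\
  forall y, lspan any_monomial y -> lspan any_monomial (teval g t ** y) by [].
elim: t => [v|e|e||t [IH1 IH2]|t [IHt1 IHt2] u [IHu1 IHu2]
           |t [IHt1 IHt2] u [IHu1 IHu2]|a t [IH1 IH2]] /=.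
- by split; [exact: span_fv|move=> y; exact: span_fv_mul].
- by split; [exact: span_fe|move=> y; exact: span_fe_mul].
- by split; [exact: span_fs|move=> y; exact: span_fs_mul].
- by split=> [|y _]; rewrite ?numul0r; exact: lspan_nil.
- rewrite -scaleN1r; split=> [|y /IH2 h]; first exact: lspanZ.
  by rewrite -nuscalerAl; exact: lspanZ.
- split=> [|y hy]; first exact: lspanD.
  by rewrite numulDl; apply: lspanD; auto.
- by split=> [|y hy]; rewrite -?mulgA; auto.
- by split=> [|y hy]; rewrite -?nuscalerAl; apply: lspanZ; auto.
Qed.

(** * Homogeneous elements *)

Local Notation comp := (leavitt_component g).

Lemma component0 n : comp n 0.
Proof.
exists 0%N, (fun=> 0); do 2 (unshelve eexists; first by case).
by split; [case|rewrite big_ord0].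
Qed.

Lemma component_cons (n : int) c a b m x : monomial a b m -> a%:Z - b%:Z = n ->
  comp n x -> comp n (c *: m + x).
Proof.
move=> [p [q [rpq pa qb ->]]] abn [k [cs [mu [nu [hmn ->]]]]].
pose ext T (y : T) (f : 'I_k -> T) (i : 'I_k.+1) :=
  if unlift ord0 i is Some j then f j else y.
exists k.+1, (ext _ c cs), (ext _ p mu), (ext _ q nu); split.
  by move=> i; rewrite /ext; case: unliftP => [j _|_]; rewrite ?pa ?qb.
rewrite big_ord_recl /ext unlift_none; congr (_ + _).
by apply: eq_bigr => i _; rewrite liftK.
Qed.

Lemma homogeneous_decomposition x : lspan any_monomial x ->
  exists2 f : int -> L, (forall n, comp n (f n)) & finsum_to f x.
Proof.
move=> hx; pose decomposable y :=
  exists2 f : int -> L, (forall n, comp n (f n)) & finsum_to f y.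
(* Adding x to an arbitrary y lets the monomials be added one at a time. *)
suff h y : decomposable y -> decomposable (x + y).
  rewrite -[x]addr0; apply: h.
  by exists (fun=> 0); [move=> n; exact: component0|exact: finsum_to0].
elim: hx y => [|x1 x2 _ IH1 _ IH2|c m [a [b hm]]] y.
- by rewrite add0r.
- by rewrite -addrA => /IH2/IH1.
case=> f hf fy.
exists (fun n => (if n == a%:Z - b%:Z then c *: m else 0) + f n).
  move=> n; case: eqP => [->|_]; last by rewrite add0r.
  by apply: component_cons hm _ _.
apply: finsum_toD fy; apply: (@finsum_to_single _ _ _ (a%:Z - b%:Z)).
  by rewrite eqxx.
by move=> j /negbTE ->.
Qed.

(** A bounded piece of the component of degree a - b. The bound d is the
    induction parameter of the proof; a and b count edges that can be removed
    from every monomial on the left and on the right. *)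
Definition diag_span (a b d : nat) : L -> Prop :=
  lspan (fun m => exists2 k, (k <= d)%N & monomial (a + k) (b + k) m).

Lemma component_diag_span n x : comp n x ->
  exists a b d, diag_span a b d x.
Proof.
move=> [k [c [mu [nu [hmn ->]]]]]; case: n hmn => n hmn.
  (* In degree n >= 0 the offset k of a monomial mu nu^* is |nu|. *)
  exists n, 0%N, (\max_(i < k) fp_len (nu i)); apply: lspan_sum => i _.
  apply/lspanZ/lspan_gen; exists (fp_len (nu i)); first exact: leq_bigmax.
  have [rr hl] := hmn i; exists (mu i), (nu i); split=> //.
  by apply/eqP; rewrite -eqz_nat PoszD -hl subrK.
(* In degree - n.+1 it is |mu|. *)
exists 0%N, n.+1, (\max_(i < k) fp_len (mu i)); apply: lspan_sum => i _.
apply/lspanZ/lspan_gen; exists (fp_len (mu i)); first exact: leq_bigmax.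
have [rr hl] := hmn i; exists (mu i), (nu i); split=> //.
apply/eqP; rewrite -eqz_nat PoszD -(opprK n.+1%:Z) -NegzE -hl opprB subrK //.
Qed.

Lemma diag_span_fs a b d e x :
  diag_span a.+1 b d x -> diag_span a b d (fs g e ** x).
Proof.
elim=> [|y z _ IHy _ IHz|c m [k kd hm]].
- by rewrite numulr0; exact: lspan_nil.
- by rewrite numulDr; exact: lspanD.
have [f [m' [-> hm' rm']]] := monomial_unconsl hm.
rewrite -nuscalerAr fs_fe_mul //; apply: lspanZ.
by case: ifP => _; [apply: lspan_gen; exists k|exact: lspan_nil].
Qed.

Lemma diag_span_fe a b d e x :
  diag_span a b.+1 d x -> diag_span a b d (x ** fe g e).
Proof.
elim=> [|y z _ IHy _ IHz|c m [k kd hm]].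
- by rewrite numul0r; exact: lspan_nil.
- by rewrite numulDl; exact: lspanD.
have [f [m' [-> hm' rm']]] := monomial_unconsr hm.
rewrite -nuscalerAl mul_fs_fe //; apply: lspanZ.
by case: ifP => _; [apply: lspan_gen; exists k|exact: lspan_nil].
Qed.

(** The elements e e^* are orthogonal idempotents, and e e^* fixes the
    monomials beginning with e. So this form of (CK2) holds at every vertex,
    provided that no monomial of x has a vertex as its left factor. *)
Lemma diag_span_expandl a b d x : diag_span a.+1 b d x ->
  finsum_to (fun e => fe g e ** (fs g e ** x)) x.
Proof.
elim=> [|y z _ hy _ hz|c m [k kd hm]].
- by apply: finsum_to_eq finsum_to0 => // e; rewrite !numulr0.
- by apply: finsum_to_eq (finsum_toD hy hz) => // e; rewrite !numulDr.
have [f [m' [-> hm' rm']]] := monomial_unconsl hm.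
apply: (@finsum_to_single _ _ _ f) => [|e ne].
  by rewrite -!nuscalerAr fs_fe_mul // eqxx.
by rewrite -nuscalerAr mulgA fs_fe0 // numul0r scaler0 numulr0.
Qed.

Lemma diag_span_expandr a b d x : diag_span a b.+1 d x ->
  finsum_to (fun e => x ** fe g e ** fs g e) x.
Proof.
elim=> [|y z _ hy _ hz|c m [k kd hm]].
- by apply: finsum_to_eq finsum_to0 => // e; rewrite !numul0r.
- by apply: finsum_to_eq (finsum_toD hy hz) => // e; rewrite !numulDl.
have [f [m' [-> hm' rm']]] := monomial_unconsr hm.
apply: (@finsum_to_single _ _ _ f) => [|e ne].
  by rewrite -!nuscalerAl mul_fs_fe // eqxx.
by rewrite -!nuscalerAl -(mulgA m') fs_fe0 1?eq_sym // numulr0 numul0r scaler0.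
Qed.

Lemma sum_vertex_multiples z : lspan (fun m : L => exists v, m = fv g v) z ->
  finsum_to (fun v => fv g v ** z) z /\
  forall v, exists c, fv g v ** z = c *: fv g v.
Proof.
elim=> [|y w _ [hy cy] _ [hw cw]|c _ [v ->]].
- split; first by apply: finsum_to_eq finsum_to0 => // v; rewrite numulr0.
  by move=> v; exists 0; rewrite numulr0 scale0r.
- split.
    by apply: finsum_to_eq (finsum_toD hy hw) => // v; rewrite numulDr.
  move=> v; have [[c1 h1] [c2 h2]] := (cy v, cw v).
  by exists (c1 + c2); rewrite numulDr h1 h2 scalerDl.
split=> [|w].
  apply: (@finsum_to_single _ _ _ v) => [|w ne]; rewrite -nuscalerAr ?fvv //.
  by rewrite fvw ?scaler0.
rewrite -nuscalerAr; have [->|ne] := eqVneq w v; first by exists c; rewrite fvv.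
by exists 0; rewrite fvw // scaler0 scale0r.
Qed.

Lemma diag_span_split d x : diag_span 0 0 d x ->
  exists z y : L, [/\ lspan (fun m : L => exists v, m = fv g v) z, x = z + y
    & if d is d'.+1 then diag_span 1 1 d' y else y = 0].
Proof.
elim=> [|x1 x2 _ [z1 [y1 [hz1 -> hy1]]] _ [z2 [y2 [hz2 -> hy2]]]
                     |c m [k kd hm]].
- exists 0, 0; rewrite addr0; split; [exact: lspan_nil|by []|].
  by case: (d) => [|d']; [reflexivity|exact: lspan_nil].
- exists (z1 + z2), (y1 + y2); split; [exact: lspanD|by rewrite addrACA|].
  by case: (d) hy1 hy2 => [-> ->|d']; [rewrite addr0|exact: lspanD].
case: k kd hm => [_ /monomial00 hm|k kd hm].
  exists (c *: m), 0; rewrite addr0; split; [exact/lspanZ/lspan_gen|by []|].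
  by case: (d) => [|d']; [reflexivity|exact: lspan_nil].
exists 0, (c *: m); rewrite add0r; split=> //; first exact: lspan_nil.
by case: (d) kd => // d' kd; apply/lspanZ/lspan_gen; exists k.
Qed.

(** (CK2) trades a regular vertex for monomials that have an edge on both
    sides, which is how the vertex part of a degree-zero element is absorbed. *)
Lemma regular_diag_span v d : regular v -> diag_span 1 1 d (fv g v).
Proof.
move=> rv; case: hg => _ _ _ _ /(_ v rv) ->.
rewrite fsbig_finite; last by case: rv.
apply: lspan_sum => e _; apply: lspan_gen; exists 0%N => //.
have h : walk_from (src e) [:: e] by rewrite /= eqxx.
by exists (FPath h), (FPath h).
Qed.

(** * Ideals without multiples of vertices *)

Section FaithfulIdeal.
Variable J : L -> Prop.
Hypothesis J_mull : forall u x, J x -> J (u ** x).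
Hypothesis J_mulr : forall u x, J x -> J (x ** u).
Hypothesis J_vertex : forall v r, J (r *: fv g v) -> r = 0.

(** Let T be the finite set of first edges of y. If some edge e of source v is
    not in T, then e^* y = 0 and e^* (z + y) e = c r(e). Otherwise the edges of
    source v are among T; since v is singular there is none, so that v y = 0
    and v (z + y) = c v. *)
Lemma singular_coefficient0 d v c z y :
  ~ regular v -> fv g v ** z = c *: fv g v -> diag_span 1 1 d y ->
  J (z + y) -> c = 0.
Proof.
move=> nreg vz hy Jx.
have [T uT yT] := finsum_to_seq (diag_span_expandl hy).
have [[e [se eT]]|noe] := pselect (exists e, src e = v /\ e \notin T).
  have ey : fs g e ** y = 0.
    rewrite yT numul_sumr big_seq big1 // => f fT.
    rewrite mulgA fs_fe0 ?numul0r //.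
    by apply: contraNneq eT => ->.
  apply: (J_vertex (v := rng e)); have := J_mulr (fe g e) (J_mull (fs g e) Jx).
  rewrite numulDr ey addr0 -{1}(fs_src e) se -(mulgA (fs g e)) vz.
  by rewrite -nuscalerAr -nuscalerAl -se fs_src fs_fe.
apply: (J_vertex (v := v)); have := J_mull (fv g v) Jx; rewrite numulDr vz.
suff -> : fv g v ** y = 0 by rewrite addr0.
have sv e : src e <> v.
  move=> se; apply: nreg; split; last by exists e.
  apply: (sub_finite_set _ (finite_seq T)) => f /= sf.
  by apply: contrapT => /negP fT; apply: noe; exists f.
rewrite yT numul_sumr big1 // => e _.
have ve : fv g v ** fe g e = 0.
  by rewrite -src_fe mulgA fvw ?numul0r // eq_sym; apply/eqP/sv.
by rewrite mulgA ve numul0r.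
Qed.

Lemma ideal_diag_span0 a b d :
  (forall x, diag_span 0 0 d x -> J x -> x = 0) ->
  forall x, diag_span a b d x -> J x -> x = 0.
Proof.
move=> h; elim: a => [|a IHa].
  elim: b => [//|b IHb] x hx Jx.
  have [T _ ->] := finsum_to_seq (diag_span_expandr hx).
  rewrite big1 // => e _; rewrite (IHb (x ** fe g e)) ?numul0r //.
    exact: diag_span_fe.
  exact: J_mulr.
move=> x hx Jx; have [T _ ->] := finsum_to_seq (diag_span_expandl hx).
rewrite big1 // => e _; rewrite (IHa (fs g e ** x)) ?numulr0 //.
  exact: diag_span_fs.
exact: J_mull.
Qed.

Lemma ideal_homogeneous0 d a b x : diag_span a b d x -> J x -> x = 0.
Proof.
elim: d a b x => [|d IHd] a b; apply: ideal_diag_span0 => x.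
  move=> /diag_span_split [z [y [hz -> ->]]]; rewrite addr0 => Jz.
  have [zs zv] := sum_vertex_multiples hz.
  have [V _ ->] := finsum_to_seq zs; rewrite big1 // => v _.
  have [c vz] := zv v.
  by rewrite vz (J_vertex (v := v) (r := c)) ?scale0r // -vz; exact: J_mull.
move=> /diag_span_split [z [y [hz -> hy]]] Jx.
have [zs zv] := sum_vertex_multiples hz.
apply: (IHd 1%N 1%N) => //; apply: (lspanD _ hy).
have [V _ ->] := finsum_to_seq zs; apply: lspan_sum => v _.
have [c vz] := zv v; rewrite vz; have [rv|nrv] := pselect (regular v).
  exact/lspanZ/regular_diag_span.
by rewrite (singular_coefficient0 nrv vz hy Jx) // scale0r; exact: lspan_nil.
Qed.

End FaithfulIdeal.

End LeavittPathAlgebra.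

Theorem theorem3p10 (E : graph) (R : comPzRingType)
    (L : nuAlgType R) (g : Efamily E L) (hL : is_leavitt_path_algebra g)
    (A : nuRingType) (A_ : int -> set A) (hA : graded_ring A_)
    (pi : L -> A) (hpi : graded_hom (leavitt_component g) A_ pi)
    (hv : forall (v : vertex E) (r : R), r != 0 -> pi (r *: fv g v) != 0) :
  injective pi.
Proof.
have [hg _] := hL; have [[piD piM] pi_] := hpi.
have pi0 : pi 0 = 0 by apply: (addrI (pi 0)); rewrite -piD !addr0.
have ker_homogeneous n x : leavitt_component g n x -> pi x = 0 -> x = 0.
  move=> /component_diag_span[a [b [d hx]]].
  apply: (ideal_homogeneous0 hg (J := fun y => pi y = 0) _ _ _ hx)
    => [u y|u y|v r].
  - by rewrite piM => ->; rewrite numulr0.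
  - by rewrite piM => ->; rewrite numul0r.
  - by move=> h; apply: contrapT => /eqP /(hv v); rewrite h eqxx.
have ker x : pi x = 0 -> x = 0.
  have [t ->] := leavitt_generated hL x.
  have [f fn /finsum_to_seq[s us ->]] :=
    homogeneous_decomposition (span_teval hg t).
  rewrite (big_morph pi piD pi0) => pis0.
  have [_ _ _ indep] := hA.
  rewrite big_seq_cond big1 // => n /andP[ns _].
  apply: ker_homogeneous (fn n) _.
  by apply: (indep s (fun n => pi (f n))) => // i; exact: pi_.
move=> x y xy; apply: subr0_eq; apply: ker.
by apply: (addIr (pi y)); rewrite -piD subrK add0r.
Qed.
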